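(* Let $\Gamma$ be the marked group $\mathbb{Z}/3\mathbb{Z}\times\mathbb{Z}$ with generating set $\{(1,0),(2,0),(0,1),(0,-1)\}$. Then $\chi_B(F(2^\Gamma))=3$.
   Context: A marked group is a finitely generated group $\Gamma$ with a finite symmetric generating set $S$ not containing the identity. The left shift action of $\Gamma$ on $2^\Gamma$ is $(g\cdot x)(h)=x(g^{-1}h)$; its free part is $F(2^\Gamma)=\{x\in 2^\Gamma : g\cdot x\neq x \text{ for all } g\neq \mathrm{id}\}$. The shift graph $F(2^\Gamma)$ is the graph on this free part joining distinct $x,y$ iff $s\cdot x=y$ for some $s\in S$. $\chi_B(G)$ denotes the Borel chromatic number: the least $k$ such that there is a Borel map $c$ from the vertex set to a $k$-element set with $c(x)\neq c(y)$ for adjacent $x,y$. *)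

(* Defs.v *)
From HB Require Import structures.
From mathcomp Require Import all_boot all_order all_algebra.
From mathcomp Require Import all_classical all_reals all_analysis.

Set Implicit Arguments.
Unset Strict Implicit.
Unset Printing Implicit Defensive.

Import Order.TTheory GRing.Theory Num.Theory.

Local Open Scope classical_set_scope.
Local Open Scope ring_scope.

Definition borel {T : topologicalType} : set (set T) := <<s @open T >>.

Definition borel_colorable (T : topologicalType) (E : T -> T -> Prop) (k : nat) :=
  exists c : T -> 'I_k,
    (forall A : set 'I_k, borel (c @^-1` A)) /\
    (forall x y : T, E x y -> c x <> c y).

(* A relation rather than a function, since the Borel chromatic number of a
   graph need not be finite. *)
Definition is_borel_chromatic_number
    (T : topologicalType) (E : T -> T -> Prop) (k : nat) :=
  borel_colorable E k /\ (forall j : nat, borel_colorable E j -> (k <= j)%N).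

(* Marked groups and their shifts, for abelian groups in additive notation. *)
Definition marking (G : zmodType) (S : seq G) : Prop :=
  [/\ (forall s, s \in S -> - s \in S),
      0 \notin S &
      forall H : set G,
        H 0 -> (forall g h, H g -> H h -> H (g - h)) ->
        (forall s, s \in S -> H s) -> H = setT].

Definition shift_act (G : zmodType) (g : G) (x : {ptws G -> bool}) :
    {ptws G -> bool} :=
  fun h => x (- g + h).

Definition free_part (G : zmodType) : set {ptws G -> bool} :=
  [set x | forall g : G, g <> 0 -> shift_act g x <> x].
Arguments free_part : clear implicits.

(* [set_type] carries the topology induced by the product topology on
   [{ptws G -> bool}], with [bool] discrete. *)
Definition free_space (G : zmodType) : topologicalType :=
  set_type (free_part G).

Definition shift_graph (G : zmodType) (S : seq G) (x y : free_space G) : Prop :=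
  x <> y /\ exists2 s, s \in S & shift_act s (set_val x) = set_val y.

Definition Z3xZ : zmodType := ('Z_3 * int)%type.

Definition Z3xZ_gens : seq Z3xZ := [:: (1, 0); (2, 0); (0, 1); (0, -1)].

Lemma Z3xZ_marking : marking Z3xZ_gens.
Proof.
split=> //.
- move=> s; rewrite !inE => /or4P[] /eqP->; apply/or4P.
  + exact: Or42.
  + exact: Or41.
  + exact: Or44.
  + exact: Or43.
- move=> H H0 HB HS.
  have HN g : H g -> H (- g) by move=> Hg; rewrite -sub0r; exact: HB.
  have HD g h : H g -> H h -> H (g + h).
    by move=> Hg /HN Hh; rewrite -[h]opprK; exact: HB.
  have HM g n : H g -> H (g *+ n).
    by move=> Hg; elim: n => [|n IH]; rewrite ?mulr0n// mulrS; exact: HD.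
  have HZ g (z : int) : H g -> H (g *~ z).
    by move=> Hg; case: z => n; [exact: HM|exact/HN/HM].
  rewrite -subTset => -[a b] _.
  have -> : ((a, b) : Z3xZ) = ((1, 0) : Z3xZ) *+ a + ((0, 1) : Z3xZ) *~ b.
    have eM n : ((1, 0) : Z3xZ) *+ n = (n%:R, 0).
      by elim: n => // n IH; rewrite mulrS IH mulrS; congr (_, _).
    have eN n : ((0, 1) : Z3xZ) *+ n = (0, n%:Z).
      elim: n => // n IH; rewrite mulrS IH intS.
      by apply/pair_equal_spec; rewrite /= add0r.
    have eZ (z : int) : ((0, 1) : Z3xZ) *~ z = (0, z).
      case: z => n; first exact: eN.
      rewrite NegzE mulrNz [_ *~ _]eN.
      by apply/pair_equal_spec; rewrite /= oppr0.
    rewrite eM eZ; apply/pair_equal_spec; split; last by rewrite /= add0r.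
    by rewrite /= addr0 natr_Zp.
  by apply: HD; [apply: HM|apply: HZ]; apply: HS.
Qed.

(* Main.v *)
Require Import Defs.
From mathcomp Require Import all_boot all_order all_algebra.
From mathcomp Require Import all_classical all_reals all_analysis.

Set Implicit Arguments.
Unset Strict Implicit.
Unset Printing Implicit Defensive.

Import Order.TTheory GRing.Theory Num.Theory.

Local Open Scope classical_set_scope.
Local Open Scope ring_scope.

(** A triangle of the graph is an orbit of [rot = (1, 0)], so three colors are
    necessary. For the converse we look for a Borel [c : 2^G -> Z/3] with
    [c (rot x) = c x + 1] and [c (trans x) <> c x] on the free part. Reading the
    rows of [x] in a fixed order, the first nonconstant row has a unique entry
    in the minority; its position [p x] is an equivariant Borel map. Rotating
    [x] by [- p x] gives a rot-invariant configuration [aligned x] which differs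
    from [aligned (trans x)] on the free part, and the coordinate where they
    differ yields countably many rot-invariant sets that cover the free part and
    contain no two trans-adjacent points. Running through these sets and giving
    each of their points a color avoided by its two trans-neighbors (three
    colors suffice) repairs [p] into [c]: each point is recolored at most once,
    because an edge that is properly colored stays so. *)

(** * Borel maps into discrete codomains *)

Section BorelFun.
Variable T : topologicalType.

Definition borel_fun (C : Type) (f : T -> C) :=
  forall A : set C, borel (f @^-1` A).

Lemma borel_bigcup (A : nat -> set T) :
  (forall n, borel (A n)) -> borel (\bigcup_n A n).
Proof. exact: sigma_algebra_bigcup. Qed.

Lemma borelC (A : set T) : borel A -> borel (~` A).
Proof.
by rewrite -setTD; exact: sigma_algebraCD.
Qed.

Lemma borel0 : borel (set0 : set T).
Proof. exact: sigma_algebra0. Qed.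

Lemma borel_bigcap (A : nat -> set T) :
  (forall n, borel (A n)) -> borel (\bigcap_n A n).
Proof.
move=> bA; rewrite -[X in borel X]setCK setC_bigcap.
by apply: borelC; apply: borel_bigcup => n; exact: borelC.
Qed.

Lemma borelI (A B : set T) : borel A -> borel B -> borel (A `&` B).
Proof.
move=> bA bB; rewrite -bigcap2inE.
rewrite (_ : \bigcap_(i < 2) _ = \bigcap_i (if i is 0 then A else B)); last first.
  apply/seteqP; split=> [x h [|n] _|x h [|[|n]] //= _].
  - exact: (h 0%N).
  - exact: (h 1%N).
  - exact: (h 0%N I).
  - exact: (h 1%N I).
by apply: borel_bigcap => -[].
Qed.

Lemma borel_fun_cst (C : Type) (c : C) : borel_fun (fun=> c).
Proof.
move=> A; have [Ac|Ac] := pselect (A c).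
  rewrite (_ : _ @^-1` _ = ~` set0); first by apply: borelC; exact: borel0.
  by rewrite setC0; apply/seteqP; split=> x.
rewrite (_ : _ @^-1` _ = set0); first exact: borel0.
by apply/seteqP; split=> x.
Qed.

(** The preimage splits into countably many pieces, one for each value of [f]. This lets a composite
    expression be treated one subterm at a time. *)
Lemma borel_fun_bind (C : countType) (D : Type) (f : T -> C) (g : C -> T -> D) :
  borel_fun f -> (forall c, borel_fun (g c)) -> borel_fun (fun x => g (f x) x).
Proof.
move=> bf bg A.
rewrite (_ : _ @^-1` _ = \bigcup_n (if unpickle n is Some c
    then f @^-1` [set c] `&` g c @^-1` A else set0)); last first.
  apply/seteqP; split=> [x Ax|x [n _]].
    by exists (pickle (f x)) => //; rewrite pickleK.
  by case: (unpickle n) => // c [/= ->].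
apply: borel_bigcup => n; case: (unpickle n) => [c|]; last exact: borel0.
by apply: borelI; [exact: bf|exact: bg].
Qed.

Lemma borel_fun_comp (C : Type) (D : Type) (f : T -> C) (g : C -> D) :
  borel_fun f -> borel_fun (fun x => g (f x)).
Proof. by move=> bf A; apply: (bf (g @^-1` A)). Qed.

(** The limit lies in [A] exactly when a whole tail of the sequence does, so its preimage is a
    countable union of countable intersections. *)
Lemma borel_fun_lim (C : Type) (u : nat -> T -> C) :
  (forall n, borel_fun (u n)) ->
  (forall x, exists N, forall n, (N <= n)%N -> u n x = u N x) ->
  exists2 f, borel_fun f &
    forall x, exists N, forall n, (N <= n)%N -> u n x = f x.
Proof.
move=> bu /choice[N uN]; exists (fun x => u (N x) x); last first.
  by move=> x; exists (N x); apply: uN.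
move=> A.
rewrite (_ : _ @^-1` _ = \bigcup_m \bigcap_n (u (m + n)%N @^-1` A)).
  by apply: borel_bigcup => m; apply: borel_bigcap => n; apply: bu.
apply/seteqP; split=> [x Ax|x [m _ h]].
  by exists (N x) => // n _; rewrite /= uN ?leq_addr.
by move: (h (N x) I); rewrite /= uN ?leq_addl.
Qed.

End BorelFun.

Lemma borel_preimage (S T : topologicalType) (f : S -> T) (A : set T) :
  continuous f -> borel A -> borel (f @^-1` A).
Proof.
(* The sets with Borel preimage form a sigma-algebra that contains the open sets. *)
move=> /continuousP cf; apply: (@smallest_sub _ _ _ [set B | borel (f @^-1` B)]).
  split=> [|B|B] /=.
  - by rewrite preimage_set0; exact: borel0.
  - by rewrite setTD preimage_setC; apply: borelC.
  - by rewrite preimage_bigcup; apply: borel_bigcup.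
by move=> B oB; apply: sub_sigma_algebra; apply: cf.
Qed.

Lemma borel_fun_continuous (S T : topologicalType) (C : Type) (f : S -> T)
    (g : T -> C) :
  continuous f -> borel_fun g -> borel_fun (g \o f).
Proof. by move=> cf bg A; rewrite comp_preimage; apply: borel_preimage. Qed.

Lemma ptws_eval_continuous (I : eqType) (i : I) :
  continuous (fun x : {ptws I -> bool} => x i).
Proof. exact: (@proj_continuous I (fun=> bool)). Qed.

Lemma borel_fun_eval (I : eqType) (i : I) :
  borel_fun (fun x : {ptws I -> bool} => x i).
Proof.
move=> A; apply: sub_sigma_algebra.
have /continuousP := @ptws_eval_continuous I i.
by apply; exact: discrete_open.
Qed.

(** * The shift action and its point masses *)

Section ShiftAction.
Variable G : zmodType.
Implicit Types (g h : G) (x : {ptws G -> bool}).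

Lemma shift_actD g h x : shift_act g (shift_act h x) = shift_act (g + h) x.
Proof. by apply/funext => k; rewrite /shift_act opprD addrA [- g - h]addrC. Qed.

Lemma shift_act0 x : shift_act 0 x = x.
Proof. by apply/funext => k; rewrite /shift_act oppr0 add0r. Qed.

Lemma shift_act_continuous g : continuous (shift_act g).
Proof.
move=> x; apply/cvg_sup => h U [V [[W oW <-] Wx WU]].
apply: (filterS WU); apply: (@ptws_eval_continuous G (- g + h) x).
exact: open_nbhs_nbhs.
Qed.

Lemma free_part_shift g x : free_part G x -> free_part G (shift_act g x).
Proof.
move=> fx h h0; rewrite shift_actD addrC -shift_actD => e; apply: (fx h h0).
have := congr1 (shift_act (- g)) e.
by rewrite !shift_actD addNr shift_act0 add0r.
Qed.

Lemma free_part_delta g : free_part G (fun h => h == g).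
Proof.
move=> k k0 /(congr1 (fun x : {ptws G -> bool} => x (k + g))).
rewrite /shift_act addKr eqxx => /esym.
by rewrite -{2}[g]add0r (inj_eq (addIr g)) => /eqP.
Qed.

Definition delta_point g : free_space G := SigSub (mem_set (@free_part_delta g)).

Lemma set_val_delta_point g : set_val (delta_point g) = (fun h => h == g).
Proof. by rewrite set_valE. Qed.

(** The shift by [h - g] carries the point mass at [g] to the one at [h]. Point masses thus supply
    explicit edges for the lower bound. *)
Lemma shift_graph_delta (S : seq G) g h : g != h -> h - g \in S ->
  shift_graph S (delta_point g) (delta_point h).
Proof.
move=> gh S_hg; split.
  move=> /(congr1 (fun x : free_space G => set_val x g)); rewrite !set_val_delta_point eqxx => /esym.
  by apply/negP.
exists (h - g) => //; apply/funext => k; rewrite !set_val_delta_point.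
rewrite /shift_act opprB -(subr_eq0 _ g) addrAC [g - h]addrC addrK addrC.
by rewrite subr_eq0.
Qed.

End ShiftAction.

(* Searching for the new color relative to [a] makes [recolor] commute with
   translations. *)
Definition recolor (a b d : 'Z_3) : 'Z_3 :=
  if a \notin [:: b; d] then a
  else if a + 1 \notin [:: b; d] then a + 1 else a + 2.

Lemma recolor_avoid a b d : recolor a b d \notin [:: b; d].
Proof. by case: a b d => [[|[|[|//]]] ?] [[|[|[|//]]] ?] [[|[|[|//]]] ?]. Qed.

Lemma recolor_id a b d : a != b -> a != d -> recolor a b d = a.
Proof. by move=> ab ad; rewrite /recolor !inE negb_or ab ad. Qed.

Lemma recolorD a b d k : recolor (a + k) (b + k) (d + k) = recolor a b d + k.
Proof.
rewrite /recolor !inE ![a + k + _]addrAC !(inj_eq (addIr k)).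
by do 2 case: ifP => _ //.
Qed.

(** * Repairing a coloring along independent sets *)

Section Recoloring.
Variables (T : Type) (t t' : T -> T) (V : nat -> T -> bool) (c0 : T -> 'Z_3).
Hypotheses (tK : cancel t t') (t'K : cancel t' t).
Hypothesis V_indep : forall n x, V n x -> ~~ V n (t x).

Fixpoint recoloring n x : 'Z_3 :=
  if n is m.+1 then
    if V m x then
      recolor (recoloring m x) (recoloring m (t x)) (recoloring m (t' x))
    else recoloring m x
  else c0 x.

Let good n x := recoloring n x != recoloring n (t x).

(** By independence at most one end of the edge from [x] to [t x] is recolored at step [n], and its
    new color avoids the current color of the other end. If neither is recolored, a good edge stays
    good. *)
Lemma recoloring_goodS n x :
  [|| V n x, V n (t x) | good n x] -> good n.+1 x.
Proof.
rewrite /good /=; have [Vx _|Vx] := ifPn.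
  rewrite (negPf (V_indep Vx)).
  have := recolor_avoid (recoloring n x) (recoloring n (t x))
    (recoloring n (t' x)).
  by rewrite !inE negb_or => /andP[].
have [Vtx _|//] := ifPn.
have := recolor_avoid (recoloring n (t x)) (recoloring n (t (t x)))
  (recoloring n (t' (t x))).
by rewrite tK !inE negb_or eq_sym => /andP[_]; rewrite eq_sym.
Qed.

Lemma recoloring_good n m x :
  V n x || V n (t x) -> (n < m)%N -> recoloring m x != recoloring m (t x).
Proof.
move=> Vx; elim: m => // m IH; rewrite ltnS leq_eqVlt => /orP[/eqP<-|nm].
  by apply: recoloring_goodS; case/orP: Vx => ->; rewrite ?orbT.
by apply: recoloring_goodS; rewrite /good IH ?orbT.
Qed.

(** After step [n] both edges at [x] stay properly colored, so by [recolor_id] later visits leave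
    its color alone. *)
Lemma recoloring_stable n m x :
  V n x -> (n < m)%N -> recoloring m x = recoloring n.+1 x.
Proof.
move=> Vx; elim: m => // m IH; rewrite ltnS leq_eqVlt => /orP[/eqP<-//|nm].
rewrite [LHS]/=; case: ifP => _; last exact: IH.
rewrite recolor_id ?IH// -IH//.
  by apply: recoloring_good nm; rewrite Vx.
rewrite eq_sym -{2}[x]t'K; apply: recoloring_good nm.
by rewrite t'K Vx orbT.
Qed.

Lemma recoloring_eventually_cst x :
  exists N, forall n, (N <= n)%N -> recoloring n x = recoloring N x.
Proof.
have [[n Vx]|nV] := pselect (exists n, V n x).
  by exists n.+1 => m nm; apply: recoloring_stable.
exists 0%N => n _; elim: n => //= n ->.
by case: ifPn => // Vx; case: nV; exists n.
Qed.

End Recoloring.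

(** * The equivariant pivot *)

Definition rot : Z3xZ := (1, 0).
Definition trans : Z3xZ := (0, 1).

Lemma free_part_rot x : free_part Z3xZ x -> shift_act rot x <> x.
Proof. by apply => /pair_equal_spec[]. Qed.

Local Notation X := {ptws Z3xZ -> bool}.

(* The position of the entry that differs from the two others. *)
Definition minority (a b d : bool) : option 'Z_3 :=
  if a == b then if b == d then None else Some 2
  else if b == d then Some 0 else Some 1.

Definition row_minority (z : int) (x : X) : option 'Z_3 :=
  minority (x (0, z)) (x (1, z)) (x (2, z)).

Lemma row_minority_rot z x :
  row_minority z (shift_act rot x) = omap (+%R^~ 1) (row_minority z x).
Proof.
rewrite /row_minority /shift_act.
have -> : - rot + (0, z) = (2, z) :> Z3xZ.
  by apply/pair_equal_spec; split=> /=; rewrite ?oppr0 ?add0r//; apply/val_inj.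
have -> : - rot + (1, z) = (0, z) :> Z3xZ.
  by apply/pair_equal_spec; split=> /=; rewrite ?oppr0 ?add0r//; apply/val_inj.
have -> : - rot + (2, z) = (1, z) :> Z3xZ.
  by apply/pair_equal_spec; split=> /=; rewrite ?oppr0 ?add0r//; apply/val_inj.
by case: (x _) (x _) (x _) => -[] [] //=; congr Some; apply/val_inj.
Qed.

Lemma row_minority_None x :
  (forall z, row_minority z x = None) -> shift_act rot x = x.
Proof.
move=> h; apply/funext => -[i z]; have := h z; rewrite /row_minority /minority.
case: eqP => [e1|_]; last by case: eqP.
case: eqP => [e2|//] _.
have xE j : x (j, z) = x (0, z).
  have : j \in [:: 0; 1; 2] by case: j => [[|[|[|//]]] ?].
  by rewrite !inE => /or3P[] /eqP->; rewrite ?e1 ?e2.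
rewrite /shift_act xE.
have -> : - rot + (i, z) = (- 1 + i, z) :> Z3xZ.
  by apply/pair_equal_spec; split=> //=; rewrite oppr0 add0r.
by rewrite xE.
Qed.

(** Only the first [n] codes of rows are searched, and an answer once found is never revised; the
    unbounded search is the limit in [n]. *)
Fixpoint first_minority n (x : X) : option 'Z_3 :=
  if n is m.+1 then
    if first_minority m x is Some i then Some i
    else if unpickle m is Some z then row_minority z x else None
  else None.

Lemma first_minority_rot n x :
  first_minority n (shift_act rot x) = omap (+%R^~ 1) (first_minority n x).
Proof.
elim: n => //= n ->; case: (first_minority n x) => //=.
by case: (unpickle n) => // z; apply: row_minority_rot.
Qed.

Lemma first_minority_eventually_cst x :
  exists N, forall n, (N <= n)%N -> first_minority n x = first_minority N x.
Proof.
have [[n fx]|nf] := pselect (exists n, first_minority n x).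
  exists n; elim=> [|m IH]; first by rewrite leqn0 => /eqP->.
  rewrite leq_eqVlt => /orP[/eqP->//|]; rewrite ltnS => /IH /= ->.
  by case: (first_minority n x) fx.
exists 0%N => n _ /=; case e : first_minority => [i|//].
by case: nf; exists n; rewrite e.
Qed.

Lemma borel_fun_first_minority n : borel_fun (first_minority n).
Proof.
elim: n => [|n IH] /=; first exact: borel_fun_cst.
apply: (borel_fun_bind (g := fun o x => if o is Some i then Some i else
  if unpickle n is Some z then row_minority z x else None)) IH _ => -[i|].
  exact: borel_fun_cst.
case: (unpickle n) => [z|]; last exact: borel_fun_cst.
rewrite /row_minority.
apply: (borel_fun_bind (f := fun x : X => x (0, z))
  (g := fun a (x : X) => minority a (x (1, z)) (x (2, z)))) => [|a].
  exact: borel_fun_eval.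
apply: (borel_fun_bind (f := fun x : X => x (1, z))
  (g := fun b (x : X) => minority a b (x (2, z)))) => [|b].
  exact: borel_fun_eval.
apply: (borel_fun_comp (f := fun x : X => x (2, z))).
exact: borel_fun_eval.
Qed.

Lemma borel_equivariant_pivot : exists2 p : X -> 'Z_3, borel_fun p &
  forall x, shift_act rot x <> x -> p (shift_act rot x) = p x + 1.
Proof.
have [f bf fE] := borel_fun_lim borel_fun_first_minority
  first_minority_eventually_cst.
(* The default [0] occurs only if all rows are constant, hence only at points fixed by [rot]. *)
exists (odflt 0 \o f); first exact: borel_fun_comp.
move=> x xr /=.
have [N hN] := fE x; have [M hM] := fE (shift_act rot x).
rewrite -(hM _ (leq_maxr N M)) first_minority_rot (hN _ (leq_maxl N M)).
case e : (f x) => [//|]; case: xr; apply: row_minority_None => z.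
(* A stage beyond [pickle z] has inspected row [z]; its result [None] makes that row constant. *)
have := hN (maxn N (pickle z).+1) (leq_maxl _ _); rewrite e.
elim: (maxn N _) (leq_maxr N (pickle z).+1) => // m IH.
rewrite leq_eqVlt => /orP[/eqP[<-]|zm] /=.
  by case: first_minority => //; rewrite pickleK.
by move: (IH zm); case: first_minority => // /(_ erefl).
Qed.

(** * Rotation-invariant independent sets *)

Section Markers.
Variable p : X -> 'Z_3.
Hypothesis borel_p : borel_fun p.
Hypothesis p_rot : forall x, shift_act rot x <> x -> p (shift_act rot x) = p x + 1.

Definition aligned (x : X) : X := shift_act (- ((p x, 0) : Z3xZ)) x.

Lemma aligned_rot x : shift_act rot x <> x ->
  aligned (shift_act rot x) = aligned x.
Proof.
move=> xr; rewrite /aligned p_rot// shift_actD.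
apply: (congr1 (fun g : Z3xZ => shift_act g x)).
apply/pair_equal_spec; split=> /=; last by rewrite addr0.
by rewrite opprD addrNK.
Qed.

(** Equality would make [x] fixed by a group element whose second coordinate is 1, whatever the two
    pivots are. *)
Lemma aligned_trans x : free_part Z3xZ x ->
  aligned (shift_act trans x) <> aligned x.
Proof.
move=> fx; set y := shift_act trans x => e.
have := congr1 (shift_act ((p x, 0) : Z3xZ)) e.
rewrite /aligned !shift_actD subrr shift_act0 => e'; refine (fx _ _ e').
by move=> /pair_equal_spec[_] /=; rewrite oppr0.
Qed.

Lemma borel_fun_aligned h : borel_fun (fun x => aligned x h).
Proof.
apply: (borel_fun_bind (g := fun c (x : X) => shift_act (- ((c, 0) : Z3xZ)) x h)
  borel_p) => c.
exact: borel_fun_eval.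
Qed.

(** Prescribing the bit [b], rather than only a disagreement at [h], is what makes each set
    independent. *)
Definition marker n (x : X) : bool :=
  if unpickle n is Some (h, b) then
    (aligned x h == b) && (aligned (shift_act trans x) h == ~~ b)
  else false.

Lemma marker_indep n x : marker n x -> ~~ marker n (shift_act trans x).
Proof.
rewrite /marker; case: (unpickle n) => // -[h b] /andP[_ /eqP ->].
by case: b.
Qed.

(** Alignment absorbs rotations, and [rot] commutes with [trans]. This keeps the recoloring
    equivariant. *)
Lemma marker_rot n x : free_part Z3xZ x ->
  marker n (shift_act rot x) = marker n x.
Proof.
move=> fx; rewrite /marker; case: (unpickle n) => // -[h b].
rewrite shift_actD [trans + rot]addrC -shift_actD !aligned_rot//.
  exact/free_part_rot/free_part_shift.
exact: free_part_rot.
Qed.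

Lemma marker_cover x : free_part Z3xZ x -> exists n, marker n x.
Proof.
move=> fx; have [h xh] : exists h, aligned x h != aligned (shift_act trans x) h.
  apply: contrapT => nh; apply: (aligned_trans fx); apply/funext => h.
  by apply/eqP; rewrite eq_sym; apply: contra_notT nh => xh; exists h.
exists (pickle ((h, aligned x h) : ('Z_3 * int) * bool)).
rewrite /marker pickleK eqxx /=.
by case: (aligned x h) xh; case: (aligned _ h).
Qed.

Lemma borel_fun_marker n : borel_fun (marker n).
Proof.
rewrite /marker; case: (unpickle n) => [[h b]|]; last exact: borel_fun_cst.
apply: (borel_fun_bind (f := fun x => aligned x h) (g := fun a x =>
  (a == b) && (aligned (shift_act trans x) h == ~~ b))) => [|a].
  exact: borel_fun_aligned.
apply: (borel_fun_comp (f := fun x => aligned (shift_act trans x) h)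
  (fun d => (a == b) && (d == ~~ b))).
exact: (borel_fun_continuous (@shift_act_continuous _ trans)
  (borel_fun_aligned h)).
Qed.

End Markers.

(** * The equivariant coloring and the chromatic number *)

Lemma borel_equivariant_coloring : exists2 c : X -> 'Z_3, borel_fun c &
  forall x, free_part Z3xZ x ->
    c (shift_act rot x) = c x + 1 /\ c x != c (shift_act trans x).
Proof.
have [p bp pE] := borel_equivariant_pivot.
pose t := shift_act trans; pose t' := shift_act (- trans).
have tK : cancel t t' by move=> x; rewrite /t /t' shift_actD addNr shift_act0.
have t'K : cancel t' t by move=> x; rewrite /t /t' shift_actD subrr shift_act0.
pose u := recoloring t t' (marker p) p.
have indep := @marker_indep p.
have bu n : borel_fun (u n).
  elim: n => // n IH; rewrite /u /=.
  have bt g : borel_fun (u n \o shift_act g).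
    by apply: borel_fun_continuous => //; exact: shift_act_continuous.
  apply: (borel_fun_bind (g := fun (b : bool) x =>
    if b then recolor (u n x) (u n (t x)) (u n (t' x)) else u n x)
    (borel_fun_marker bp n)) => -[]; last exact: IH.
  apply: (borel_fun_bind (g := fun a x => recolor a (u n (t x)) (u n (t' x)))
    IH) => a.
  apply: (borel_fun_bind (g := fun b x => recolor a b (u n (t' x)))
    (bt trans)) => b.
  exact: (borel_fun_comp (recolor a b) (bt (- trans))).
(* Rotation preserves the markers and adds 1 to all three arguments of [recolor], so [recolorD]
   carries the induction. *)
have uE n x : free_part Z3xZ x -> u n (shift_act rot x) = u n x + 1.
  elim: n x => [|n IH] x fx; first by apply: pE; exact: free_part_rot.
  have rC g : shift_act g (shift_act rot x) = shift_act rot (shift_act g x).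
    by rewrite !shift_actD addrC.
  rewrite /u /= (marker_rot pE)// -/u -!/(u _ _) /t /t' !rC.
  rewrite !IH ?recolorD//; [|exact: free_part_shift..].
  by case: ifP.
have [c bc cE] := borel_fun_lim bu
  (recoloring_eventually_cst p tK t'K indep).
exists c => // x fx; split.
  have [N hN] := cE x; have [M hM] := cE (shift_act rot x).
  by rewrite -(hM _ (leq_maxr N M)) uE// (hN _ (leq_maxl N M)).
have [N hN] := cE x; have [M hM] := cE (shift_act trans x).
have [n Vx] := marker_cover p fx.
(* At stage [m] the edge has been repaired and both of its ends have their final colors. *)
set m := maxn n.+1 (maxn N M).
rewrite -(hN m) -?(hM m) ?leq_max ?leqnn ?orbT//.
by apply: (recoloring_good p tK indep (n := n)); rewrite ?Vx ?leq_max ?leqnn.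
Qed.

Theorem theorem2 : is_borel_chromatic_number (shift_graph Z3xZ_gens) 3.
Proof.
split.
  have [c bc cE] := borel_equivariant_coloring.
  have c_rot x : free_part Z3xZ x -> c (shift_act rot x) <> c x.
    move=> fx; rewrite (cE _ fx).1 -[RHS]addr0 => /addrI; exact/eqP.
  have c_trans x : free_part Z3xZ x -> c (shift_act trans x) <> c x.
    by move=> fx /esym/eqP; apply/negP; exact: (cE _ fx).2.
  exists (c \o set_val); split=> [A|x y [_ [s + sx]]] /=.
    by apply: (borel_fun_continuous _ bc); exact: initial_continuous.
  have fx : free_part Z3xZ (set_val x) by exact: set_valP.
  have fy : free_part Z3xZ (set_val y) by exact: set_valP.
  (* The generators [(2, 0)] and [(0, -1)] are the inverses of [rot] and [trans]; their edges are
     read backwards. *)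
  have xy : set_val x = shift_act (- s) (set_val y).
    by rewrite -sx shift_actD addNr shift_act0.
  rewrite !inE => /or4P[] /eqP sE.
  - by rewrite -sx sE => /esym; apply: c_rot.
  - rewrite xy sE (_ : - _ = rot); first exact: c_rot.
    exact/eqP.
  - by rewrite -sx sE => /esym; apply: c_trans.
  - rewrite xy sE (_ : - _ = trans); first exact: c_trans.
    exact/eqP.
move=> j [c [_ cE]].
(* The point masses at the three positions of row 0 form a triangle, so their colors are
   distinct. *)
pose v (i : 'Z_3) := c (delta_point ((i, 0) : Z3xZ)).
have vI : injective v.
  move=> i k; apply: contra_eq => ik; apply/eqP; apply: cE.
  apply: shift_graph_delta; first by apply: contra ik => /eqP[->].
  rewrite !inE; case: i ik => [[|[|[|//]]] ?]; case: k => [[|[|[|//]]] ?] //.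
by have := leq_card v vI; rewrite !card_ord.
Qed.
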